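(* Let $\mathbb{H}$ be a uniform $\mathcal{L}_{\mathbb{H}}$-layered semifield, let $\mathbb{D}$ be a uniform $\mathcal{L}_{\mathbb{D}}$-layered domain extending $\mathbb{H}$, and let $a\in\mathbb{D}$ be such that $\nu(a)\in\mathcal{G}(\mathbb{H})$. Let $\mathbb{H}[a]= \{ f(a) : f \in \mathbb{H}[x] \}$. Then $$\mathscr{U}_{\mathbb{D}}(\mathbb{H}[a]) = \mathbb{H}[a] = \mathcal{L}_{\mathbb{H}}[s(a)] \odot \mathcal{G}(\mathbb{H}).$$
   Context: A uniform $\mathcal{L}$-layered domain is a set of pairs $\mathbb{D} = \{ {}^{[l]}a : l \in \mathcal{L},\ a \in \mathcal{G}\}$, where $\mathcal{G}$ (the semiring of values, written $\mathcal{G}(\mathbb{D})$) is an ordered semiring whose addition is the maximum and which is a domain (i.e. multiplicatively cancellative), and $\mathcal{L}$ (the sorting semiring, written $\mathcal{L}_{\mathbb{D}}$) is a partially pre-ordered commutative semiring without zero, assumed additively cancellative. Multiplication is ${}^{[k]}a \cdot {}^{[l]}b = {}^{[kl]}ab$; addition is ${}^{[k]}a + {}^{[l]}b = {}^{[k]}a$ if $a>b$, ${}^{[l]}b$ if $a<b$, and ${}^{[k+l]}b$ if $a=b$. One also writes $\mathbb{D} = \mathcal{L}\odot\mathcal{G}$ and ${}^{[l]}a = l \odot a$. The sorting map is $s({}^{[l]}a)=l$ and the ghost (value) map is $\nu({}^{[l]}a)=a$. A uniform layered semifield is a uniform layered domain $\mathcal{L}\odot\mathcal{G}$ that is a semifield;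 equivalently, $\mathcal{L}$ and $\mathcal{G}$ are both semifields. If $\mathbb{D}$ extends $\mathbb{H}$ (as a layered domain) then $\mathcal{L}_{\mathbb{H}}\subseteq\mathcal{L}_{\mathbb{D}}$ and $\mathcal{G}(\mathbb{H})\subseteq\mathcal{G}(\mathbb{D})$. $\mathbb{H}[x]$ is the polynomial semiring over $\mathbb{H}$, and $\mathcal{L}_{\mathbb{H}}[s(a)] = \{g(s(a)) : g\in\mathcal{L}_{\mathbb{H}}[x]\}$; polynomials over a semiring without zero are finite nonempty formal sums of monomials. For $E\subset\mathbb{D}$, the uniform closure $\mathscr{U}_{\mathbb{D}}(E)$ is the minimal (with respect to inclusion) uniform layered domain $\mathbb{E}$ (i.e. of the form $\mathcal{L}'\odot\mathcal{G}'$ with $\mathcal{L}'\subseteq\mathcal{L}_{\mathbb{D}}$, $\mathcal{G}'\subseteq\mathcal{G}(\mathbb{D})$) with $E\subseteq\mathbb{E}\subseteq\mathbb{D}$, if it exists. *)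

(* Defs.v *)
From HB Require Import structures.
From mathcomp Require Import all_boot all_order ssralg poly.
From mathcomp Require Import boolp classical_sets.

Set Implicit Arguments.
Unset Strict Implicit.
Unset Printing Implicit Defensive.

Import Order.TTheory GRing.Theory.
Local Open Scope classical_set_scope.
Local Open Scope ring_scope.

(* Semirings in which no zero element is required; addition is written in     *)
(* ring_scope, multiplication, unit and powers in group_scope.                *)
HB.mixin Record isDistributive R of GRing.AddSemigroup R & Monoid R := {
  mulDl : forall x y z : R, ((x + y)%R * z)%g = (x * z)%g + (y * z)%g;
  mulDr : forall x y z : R, (x * (y + z)%R)%g = (x * y)%g + (x * z)%g
}.

#[short(type="semiring0freeType")]
HB.structure Definition Semiring0free :=
  {R of isDistributive R & GRing.AddSemigroup R & Monoid R}.

(* Num.POrderedZmodule also combines an addition with an order, so Hierarchy  *)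
(* Builder requires this join.                                                *)
HB.structure Definition PreorderAddMagma d :=
  {R of GRing.BaseAddMagma R & Order.Preorder d R}.

HB.mixin Record isPreorderedSemiring d R
    of Semiring0free R & Order.Preorder d R := {
  preorder_leD : forall z x y : R, (x <= y)%O -> (x + z <= y + z)%O;
  preorder_leMr : forall z x y : R, (x <= y)%O -> ((x * z)%g <= (y * z)%g)%O;
  preorder_leMl : forall z x y : R, (x <= y)%O -> ((z * x)%g <= (z * y)%g)%O
}.

HB.structure Definition PreorderedSemiring d :=
  {R of isPreorderedSemiring d R & Semiring0free R & Order.Preorder d R}.

HB.mixin Record isSorting d R of PreorderedSemiring d R := {
  sorting_mulC : forall x y : R, (x * y)%g = (y * x)%g;
  sorting_addI : forall x y z : R, x + y = x + z -> y = z
}.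

#[short(type="sortingType")]
HB.structure Definition Sorting d :=
  {R of isSorting d R & PreorderedSemiring d R}.

(* Multiplication is not assumed commutative, hence cancellation on both      *)
(* sides; polynomials are then evaluated with coefficients on the left.       *)
HB.mixin Record isValueDomain d R
    of PreorderedSemiring d R & Order.Total d R := {
  value_addE : forall x y : R, x + y = Order.max x y;
  value_mulI : forall x y z : R, (x * y)%g = (x * z)%g -> y = z;
  value_mulIr : forall x y z : R, (y * x)%g = (z * x)%g -> y = z
}.

#[short(type="valueDomainType")]
HB.structure Definition ValueDomain d :=
  {R of isValueDomain d R & PreorderedSemiring d R & Order.Total d R}.

Section ValueTheory.
Context {d : Order.disp_t} {G : valueDomainType d}.
Implicit Types x y z : G.

Lemma value_ltMr z x y : (x < y)%O -> ((x * z)%g < (y * z)%g)%O.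
Proof.
move=> lt_xy; rewrite lt_neqAle; apply/andP; split.
  by apply/eqP => /value_mulIr e; rewrite e ltxx in lt_xy.
exact/preorder_leMr/ltW.
Qed.

Lemma value_ltMl z x y : (x < y)%O -> ((z * x)%g < (z * y)%g)%O.
Proof.
move=> lt_xy; rewrite lt_neqAle; apply/andP; split.
  by apply/eqP => /value_mulI e; rewrite e ltxx in lt_xy.
exact/preorder_leMl/ltW.
Qed.

End ValueTheory.

(* Layer l a is the element written [l]a or l (.) a. *)
Record layered (dL dG : Order.disp_t) (L : sortingType dL)
    (G : valueDomainType dG) := Layer { layer_sort : L; layer_val : G }.
Arguments layer_sort {dL dG L G}.
Arguments layer_val {dL dG L G}.

Section LayeredSemiring.
Context {dL dG : Order.disp_t} {L : sortingType dL} {G : valueDomainType dG}.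
Local Notation D := (layered L G).

Definition pair_of_layered (x : D) : L * G := (layer_sort x, layer_val x).
Definition layered_of_pair (u : L * G) : D := Layer u.1 u.2.

Lemma pair_of_layeredK : cancel pair_of_layered layered_of_pair.
Proof. by case. Qed.

HB.instance Definition _ := Choice.copy D (can_type pair_of_layeredK).

Definition layered_add (x y : D) : D :=
  if (layer_val x > layer_val y)%O then x
  else if (layer_val x < layer_val y)%O then y
  else Layer (layer_sort x + layer_sort y) (layer_val y).

Definition layered_mul (x y : D) : D :=
  Layer (layer_sort x * layer_sort y)%g (layer_val x * layer_val y)%g.

Definition layered_one : D := Layer 1%g 1%g.

Lemma layered_addC : commutative layered_add.
Proof.
move=> [k a] [l b]; rewrite /layered_add /=.
by case: (ltgtP a b) => //= ->; rewrite Algebra.addrC.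
Qed.

Lemma layered_addA : associative layered_add.
Proof.
move=> [k a] [l b] [m c]; rewrite /layered_add /=.
case: (ltgtP a b) => [ab|ba|<-] /=.
- case: (ltgtP b c) => [bc|cb|<-] /=; rewrite ?ab ?(lt_gtF ab) //.
  by rewrite (lt_trans ab bc) (lt_gtF (lt_trans ab bc)).
- case: (ltgtP b c) => [bc|cb|<-] //=; rewrite ?ba //.
  by rewrite (lt_trans cb ba).
- by case: (ltgtP a c) => [ac|ca|<-] /=;
    rewrite ?ltxx ?ac ?(lt_gtF ac) ?Algebra.addrA.
Qed.

Lemma layered_mulA : associative layered_mul.
Proof. by move=> x y z; rewrite /layered_mul /= !mulgA. Qed.

Lemma layered_mul1 : left_id layered_one layered_mul.
Proof. by case=> l a; rewrite /layered_mul /= !mul1g. Qed.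

Lemma layered_mulr1 : right_id layered_one layered_mul.
Proof. by case=> l a; rewrite /layered_mul /= !mulg1. Qed.

HB.instance Definition _ := GRing.isAddSemigroup.Build D
  layered_addC layered_addA.
HB.instance Definition _ := isMonoid.Build D
  layered_mulA layered_mul1 layered_mulr1.

Lemma layered_mulDl (x y z : D) : ((x + y)%R * z)%g = (x * z)%g + (y * z)%g.
Proof.
case: x y z => [k a] [l b] [m c].
rewrite /GRing.add /mul /= /layered_add /layered_mul /=.
case: (ltgtP a b) => [ab|ba|<-] /=.
- by rewrite (value_ltMr c ab) (lt_gtF (value_ltMr c ab)).
- by rewrite (value_ltMr c ba).
- by rewrite ltxx mulDl.
Qed.

Lemma layered_mulDr (x y z : D) : (x * (y + z)%R)%g = (x * y)%g + (x * z)%g.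
Proof.
case: x y z => [m c] [k a] [l b].
rewrite /GRing.add /mul /= /layered_add /layered_mul /=.
case: (ltgtP a b) => [ab|ba|<-] /=.
- by rewrite (value_ltMl c ab) (lt_gtF (value_ltMl c ab)).
- by rewrite (value_ltMl c ba).
- by rewrite ltxx mulDr.
Qed.

HB.instance Definition _ := isDistributive.Build D layered_mulDl layered_mulDr.

End LayeredSemiring.

(* A zero is formally adjoined to R.  The polynomials over R, i.e. the finite *)
(* nonempty formal sums of monomials c x^i with c in R, are the nonzero       *)
(* elements of {poly with_zero R}: the zero coefficients stand for the        *)
(* monomials that do not occur.                                               *)
Definition with_zero (R : Type) : Type := option R.
Definition from_nz (R : Type) (x : R) : with_zero R := Some x.

HB.instance Definition _ (R : choiceType) :=
  Choice.copy (with_zero R) (option R).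

Section WithZero.
Context {R : semiring0freeType}.
Local Notation W := (with_zero R).

Definition wz_add (x y : W) : W :=
  match x, y with
  | Some a, Some b => Some (a + b)
  | Some _, None => x
  | None, _ => y
  end.

Definition wz_mul (x y : W) : W :=
  match x, y with Some a, Some b => Some (a * b)%g | _, _ => None end.

Lemma wz_addA : associative wz_add.
Proof. by case=> [a|] [b|] [c|] //=; rewrite Algebra.addrA. Qed.
Lemma wz_addC : commutative wz_add.
Proof. by case=> [a|] [b|] //=; rewrite Algebra.addrC. Qed.
Lemma wz_add0 : left_id (None : W) wz_add.
Proof. by case. Qed.
Lemma wz_mulA : associative wz_mul.
Proof. by case=> [a|] [b|] [c|] //=; rewrite mulgA. Qed.
Lemma wz_mul1 : left_id (Some 1%g : W) wz_mul.
Proof. by case=> [a|] //=; rewrite mul1g. Qed.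
Lemma wz_mulr1 : right_id (Some 1%g : W) wz_mul.
Proof. by case=> [a|] //=; rewrite mulg1. Qed.
Lemma wz_mulDl : left_distributive wz_mul wz_add.
Proof. by case=> [a|] [b|] [c|] //=; rewrite mulDl. Qed.
Lemma wz_mulDr : right_distributive wz_mul wz_add.
Proof. by case=> [a|] [b|] [c|] //=; rewrite mulDr. Qed.
Lemma wz_mul0 : left_zero (None : W) wz_mul.
Proof. by []. Qed.
Lemma wz_mulr0 : right_zero (None : W) wz_mul.
Proof. by case. Qed.
Lemma wz_one_neq0 : (Some 1%g : W) != None.
Proof. by []. Qed.

HB.instance Definition _ := GRing.isNzSemiRing.Build W
  wz_addA wz_addC wz_add0 wz_mulA wz_mul1 wz_mulr1 wz_mulDl wz_mulDr
  wz_mul0 wz_mulr0 wz_one_neq0.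

End WithZero.

Definition poly_in (R : semiring0freeType) (S : set R) :
    set {poly with_zero R} :=
  [set f : {poly with_zero R} | f != 0 /\
           forall i, f`_i = 0 \/ exists2 c, S c & f`_i = from_nz c].

Definition adjoin (R : semiring0freeType) (S : set R) (a : R) : set R :=
  [set y | exists2 f : {poly with_zero R},
             poly_in S f & f.[from_nz a] = from_nz y].

Definition subsemiring (R : semiring0freeType) (S : set R) : Prop :=
  [/\ S 1%g, forall x y, S x -> S y -> S (x + y)
    & forall x y, S x -> S y -> S (x * y)%g].

Section Uniform.
Context {dL dG : Order.disp_t} {L : sortingType dL} {G : valueDomainType dG}.
Local Notation D := (layered L G).

Definition layered_set (L' : set L) (G' : set G) : set D :=
  [set x | L' (layer_sort x) /\ G' (layer_val x)].

(* The order, cancellation and commutativity axioms pass to subsemirings. *)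
Definition uniform_layered_domain (E : set D) : Prop :=
  exists (L' : set L) (G' : set G),
    [/\ subsemiring L', subsemiring G' & E = layered_set L' G'].

Definition uniform_layered_semifield (E : set D) : Prop :=
  uniform_layered_domain E /\
  forall x, E x -> exists y, [/\ E y, (x * y = 1)%g & (y * x = 1)%g].

(* Minimality is read as being least, so that the closure is unique.          *)
Definition is_uniform_closure (E U : set D) : Prop :=
  [/\ uniform_layered_domain U, E `<=` U
    & forall V, uniform_layered_domain V -> E `<=` V -> U `<=` V].

End Uniform.

(* Main.v *)
Require Import Defs.
From mathcomp Require Import all_boot all_order ssralg poly.
From mathcomp Require Import boolp classical_sets.

(** Let [R] be a semiring without zero and [S] a subset of [R] closed under
    addition.  Then [adjoin S a] is the least subset of [R] that contains [S] and
    is closed under addition and under right multiplication by [a]: leastness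
    ([adjoin_ind]) is Horner's scheme [f = p * x + c].  The theorem is a double
    use of this characterization ([adjoin_layered_set]).

    Write [H = LH (.) GH], [s] for the sort of [a] and [v] for its value.
    Since [v] lies in [GH], the set [LH[s] (.) GH] contains [H] and has both
    closure properties, hence contains [H[a]].  Conversely, the sorts [l] such
    that [l (.) b] lies in [H[a]] for every [b] in [GH] contain [LH], are closed
    under addition because summands of equal value add up their sorts, and are
    closed under multiplication by [s] because
    [(l s) (.) b = (l (.) b v^-1) * (s (.) v)], where [v^-1] exists in [GH]
    as [H] is a semifield.  Hence they contain [LH[s]].

    As the sorting semiring is commutative, [LH[s]] is a subsemiring
    ([subsemiring_adjoin]), so [H[a] = LH[s] (.) GH] is a uniform layered
    domain, and it is then its own uniform closure. *)

Import Order.TTheory GRing.Theory.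
Local Open Scope classical_set_scope.
Local Open Scope ring_scope.

Section Adjoin.
Set Implicit Arguments.
Unset Strict Implicit.
Context {R : semiring0freeType} (S : set R) (a : R).

(** A polynomial taking a value in [R] at [a] is nonzero because the zero
    polynomial evaluates to the adjoined zero; this frees the closure proofs
    below from showing that sums and products of polynomials do not vanish. *)
Lemma adjoinI (f : {poly with_zero R}) y :
  (forall i, f`_i = 0 \/ exists2 c, S c & f`_i = from_nz c) ->
  f.[from_nz a] = from_nz y -> adjoin S a y.
Proof.
move=> fS fy; exists f => //; split => //.
by apply/eqP => f0; move: fy; rewrite f0 horner0.
Qed.

Lemma sub_adjoin : S `<=` adjoin S a.
Proof.
move=> c Sc; apply: (@adjoinI (from_nz c)%:P); last by rewrite hornerC.
by case=> [|i]; rewrite coefC /=; [right; exists c | left].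
Qed.

Lemma adjoinD : (forall x y, S x -> S y -> S (x + y)) ->
  forall x y, adjoin S a x -> adjoin S a y -> adjoin S a (x + y).
Proof.
move=> SD x y [f [_ fS] fx] [g [_ gS] gy].
apply: (@adjoinI (f + g)); last by rewrite hornerD fx gy.
move=> i; rewrite coefD.
case: (fS i) => [->|[c Sc ->]]; first by rewrite add0r; exact: gS.
case: (gS i) => [->|[e Se ->]]; right; first by exists c; rewrite ?addr0.
by exists (c + e) => //; exact: SD.
Qed.

Lemma adjoinMr x : adjoin S a x -> adjoin S a (x * a)%g.
Proof.
move=> [f [_ fS] fx]; apply: (@adjoinI (f * 'X)); last by rewrite hornerMX fx.
by move=> i; rewrite coefMX; case: eqP => _; [left | exact: fS].
Qed.

(** Induction along Horner's scheme: as coefficients stand on the left, every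
    value at [a] is reached from [S] by adding an element of [S] and multiplying
    on the right by [a]. *)
Lemma adjoin_ind (P : set R) :
    S `<=` P -> (forall x y, P x -> P y -> P (x + y)) ->
    (forall x, P x -> P (x * a)%g) ->
  adjoin S a `<=` P.
Proof.
move=> SP PD PM y [f [_ fS]]; elim/poly_ind: f y fS => [|p c IH] y fS.
  by rewrite horner0.
have pS i : p`_i = 0 \/ exists2 c, S c & p`_i = from_nz c.
  by have := fS i.+1; rewrite coefD coefMX coefC /= addr0.
have cS : c = 0 \/ exists2 e, S e & c = from_nz e.
  by have := fS 0; rewrite coefD coefMX coefC /= add0r.
rewrite hornerMXaddC.
case px: p.[from_nz a] => [x|]; case: cS => [->|[e Se ->]] //= [<-].
- exact/PM/IH.
- by apply: PD; [exact/PM/IH | exact: SP].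
- exact: SP.
Qed.

(** Commutation with [a] is what lets a coefficient standing to the right of a
    power of [a] be moved back to the left. *)
Lemma subsemiring_adjoin : subsemiring S -> (forall c, S c -> commute c a) ->
  subsemiring (adjoin S a).
Proof.
move=> [S1 SD SM] Sa; split; [exact: sub_adjoin | exact: adjoinD |].
move=> x y Ax; move: y.
suff: adjoin S a `<=` [set y | adjoin S a (x * y)%g] by [].
apply: adjoin_ind => [c Sc|y z Ay Az|y Ay] /=.
- suff: adjoin S a `<=` [set x | adjoin S a (x * c)%g] by apply.
  apply: adjoin_ind => [{Ax}x Sx|{Ax}x y Ax Ay|{Ax}x Ax] /=.
  + exact/sub_adjoin/SM.
  + by rewrite mulDl; exact: adjoinD.
  + by rewrite -mulgA -(Sa c Sc) mulgA; exact: adjoinMr.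
- by rewrite mulDr; exact: adjoinD.
- by rewrite mulgA; exact: adjoinMr.
Qed.

End Adjoin.

Section Layered.
Set Implicit Arguments.
Unset Strict Implicit.
Context {dL dG : Order.disp_t} {L : sortingType dL} {G : valueDomainType dG}.
Implicit Types (A : set L) (B : set G).

Lemma sort_layered_set A B : B 1%g -> layer_sort @` layered_set A B = A.
Proof.
move=> G1; apply/seteqP; split=> [_ [x [Lx _] <-] //|l Ll].
by exists (Layer l 1%g).
Qed.

Lemma val_layered_set A B : A 1%g -> layer_val @` layered_set A B = B.
Proof.
move=> L1; apply/seteqP; split=> [_ [x [_ Gx] <-] //|b Gb].
by exists (Layer 1%g b).
Qed.

Lemma layered_setD A B : (forall k l, A k -> A l -> A (k + l)) ->
  forall x y, layered_set A B x -> layered_set A B y ->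
    layered_set A B (x + y).
Proof.
move=> LD x y [Lx Gx] [Ly Gy]; rewrite /GRing.add /= /layered_add.
by do 2![case: ifP => _ //]; split => //=; exact: LD.
Qed.

Lemma layer_addE (k l : L) (b : G) : Layer k b + Layer l b = Layer (k + l) b.
Proof. by rewrite {1}/GRing.add /= /layered_add /= ltxx. Qed.

(** Sorts and values decouple because the inverse [w] of the value of [a] lies
    in [B]: multiplying a value by [w] on the right first makes right
    multiplication by [a] act on the sort alone. *)
Lemma adjoin_layered_set A B (a : layered L G) (w : G) :
    subsemiring A -> subsemiring B ->
    B (layer_val a) -> B w -> (w * layer_val a = 1)%g ->
  adjoin (layered_set A B) a =
    layered_set (adjoin A (layer_sort a)) B.
Proof.
move=> [L1 LD LM] [G1 GD GM] Gv Gw wv.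
apply/seteqP; split=> [|[l b] [/= Ll Gb]].
  apply: adjoin_ind => [x [Lx Gx]|x y|x [Lx Gx]].
  - by split => //; exact: sub_adjoin.
  - by apply: layered_setD; exact: adjoinD.
  - by split; [exact: adjoinMr | exact: GM].
(* The value has to vary in the induction: multiplication by [a] reaches the
   value [c] from [c * w]. *)
suff: adjoin A (layer_sort a) `<=`
    [set k | forall c, B c -> adjoin (layered_set A B) a (Layer k c)].
  by apply.
apply: adjoin_ind => [k Lk c Gc|k m Pk Pm c Gc|k Pk c Gc].
- exact: sub_adjoin.
- by rewrite -layer_addE; apply: adjoinD; [exact: layered_setD | exact: Pk |
    exact: Pm].
- suff -> : Layer (k * layer_sort a)%g c = (Layer k (c * w) * a)%g.
    exact/adjoinMr/Pk/GM.
  by rewrite {2}/mul /= /layered_mul /= -mulgA wv mulg1.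
Qed.

End Layered.

Theorem proposition5p15 (dL dG : Order.disp_t)
    (L : sortingType dL) (G : valueDomainType dG)
    (H : set (layered L G)) (hH : uniform_layered_semifield H)
    (a : layered L G) (ha : (layer_val @` H) (layer_val a)) :
  is_uniform_closure (adjoin H a) (adjoin H a) /\
  adjoin H a =
    layered_set (adjoin (layer_sort @` H) (layer_sort a))
                (layer_val @` H).
Proof.
case: hH => [[L' [G' [sL sG HE]]] Hinv]; move: ha Hinv; rewrite {H}HE.
have [[L1 _ _] [G1 _ _]] := (sL, sG).
rewrite sort_layered_set // val_layered_set // => Gv Hinv.
have [[k w] [[_ /= Gw] _ [_ wv]]] := Hinv (Layer 1%g (layer_val a)) (conj L1 Gv).
have E := adjoin_layered_set sL sG Gv Gw wv.
split=> //; split=> //.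
exists (adjoin L' (layer_sort a)), G'; split=> //.
by apply: subsemiring_adjoin => // c _; exact: sorting_mulC.
Qed.
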